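(* Let $g\ge4$, let $\ell=\prod_{p\mid\ell}p^{e_p}\ge 1$, and let $(\mathsf C,\mathsf L,\phi)$ be a level-$\ell$ curve of genus $g$ with dual graph $\Gamma$, multiplicity cochain $M$ and associated truncated valuations $\boldsymbol\nu=(\nu_p)_{p\mid\ell}$. Let $G_{\boldsymbol\nu}(\Gamma;\mu_\ell)=C^1_{\boldsymbol\nu}(\Gamma;\mu_\ell)\cap\mathrm{im}\,\delta$ (a group canonically isomorphic to the group $\underline{\mathrm{Aut}}_C(\mathsf C,\mathsf L,\phi)$ of ghost automorphisms). Then, as subgroups of $C^1(\Gamma;\mu_\ell)$, $$G_{\boldsymbol\nu}(\Gamma;\mu_\ell)=\bigoplus_{p\mid\ell}\ \sum_{1\le k\le e_p}\mathrm{im}\,\delta(\nu_p^k),$$ where $\delta(\nu_p^k)$ is the differential $C^0(\Gamma(\nu_p^k);\mu_{p^{e_p-k+1}})\to C^1(\Gamma(\nu_p^k);\mu_{p^{e_p-k+1}})$. More explicitly, setting $$\alpha_p^k:=\#V(\nu_p^{e_p-k+1})-\#V(\nu_p^{e_p-k}),$$ one has $$G_{\boldsymbol\nu}(\Gamma;\mu_\ell)\cong\bigoplus_{p\mid\ell}\bigoplus_{k=1}^{e_p}(\mu_{p^k})^{\oplus\alpha_p^k},$$ and this group has order $\frac1\ell\prod_{p\mid\ell}p^{\#V_p}$, where $V_p=\bigsqcup_{k=1}^{e_p}V(\nu_p^k)$.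
   Context: **Level curves.** The base field $k$ is algebraically closed, of characteristic prime to $\ell$. A twisted curve $\mathsf C$ is a Deligne–Mumford stack whose coarse space $C$ is a stable curve, whose smooth locus is a scheme, and whose singularities are nodes with local picture $[\{xy=0\}/\mu_r]$, $\zeta\in\mu_r$ acting by $(x,y)\mapsto(\zeta x,\zeta^{-1}y)$. A level-$\ell$ curve $(\mathsf C,\mathsf L,\phi)$ is a twisted curve with a line bundle $\mathsf L$ on whose fibres at nodes the stabilisers act faithfully, and an isomorphism $\phi\colon\mathsf L^{\otimes\ell}\to\mathcal O$, with $\mathsf L$ of order exactly $\ell$ in $\mathrm{Pic}(\mathsf C)$. Ghost automorphisms are the $\mathsf a\in\mathrm{Aut}(\mathsf C)$ (up to 2-isomorphism) inducing the identity on $C$ and with $\mathsf a^*\mathsf L\cong\mathsf L$. **Graph and multiplicity.** The dual graph $\Gamma$ has vertex set $V$ the components of the normalisation of $\mathsf C$ and edge set $E$ the nodes. $\mathbb E$ is the set of oriented edges (= branches of nodes), with orientation reversal $e\mapsto\bar e$; $e_+\in V$ is the component on which the branch $e$ lies and $e_-=(\bar e)_+$. At a node with stabiliser $\mu_r$ and chosen branch $x$, $\mathsf L$ is locally given by $\zeta\cdot(t,x,y)=(\zeta^mt,\zeta x,\zeta^{-1}y)$ with $\gcd(m,r)=1$. Set $M(e)=m\ell/r\in\mathbb Z/\ell$. Then $M(\bar e)=-M(e)$ and $r=r(e)=\ell/\gcd(M(e),\ell)$. **Cochains.** For an abelian group $A$ and a graph, $C^0(\,\cdot\,;A)$ is the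 group of $A$-valued functions on vertices and $C^1(\,\cdot\,;A)$ the group of $A$-valued functions $b$ on oriented edges with $b(\bar e)=b(e)^{-1}$ (multiplicative notation). The differential is $\delta a(e)=a(e_+)a(e_-)^{-1}$. **Valuations and contractions.** For $p\mid\ell$, $\nu_p(e)=\sup\{i: M(e)\bmod p^{e_p}\in(p^i)\subseteq\mathbb Z/p^{e_p}\}\in\{0,\dots,e_p-1\}\cup\{\infty\}$. $C^1_{\boldsymbol\nu}(\Gamma;\mu_\ell)$ is the group of $b\in C^1(\Gamma;\mu_\ell)$ with $b(e)\in\mu_{r(e)}$ for all $e$. For $0\le k\le e_p$, $\Gamma(\nu_p^k)$ is the graph obtained from $\Gamma$ by contracting every edge $e$ with $\nu_p(e)\ge k$ (i.e. $p^k$ divides $M(e)$ in $\mathbb Z/p^{e_p}$), and $V(\nu_p^k)$ is its vertex set. In particular $V(\nu_p^0)$ is a single point. $C^1(\Gamma(\nu_p^k);A)$ is regarded inside $C^1(\Gamma;A)$ by extension by the trivial element on contracted edges, and $\mu_{p^{e_p-k+1}}\subseteq\mu_\ell$. *)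

(* Defs.v *)
From HB Require Import structures.
From mathcomp Require Import all_boot all_order all_fingroup all_algebra all_solvable.

Set Implicit Arguments.
Unset Strict Implicit.
Unset Printing Implicit Defensive.

Import GroupScope GRing.Theory.

(* The finite group of l-th roots of unity in k.  The exponent is written
   l.-1.+1, which is l as soon as 0 < l, so that the type is finite for every
   l; compare 'M_n.-1.+1 in the definition of {'GL_n[R]}. *)
Section RootsOfUnity.
Variables (k : closedFieldType) (l : nat).

Definition is_mu : pred k := fun x => (x ^+ l.-1.+1 == 1)%R.
Definition mu := {x : k | is_mu x}.

HB.instance Definition _ := SubChoice.on mu.

Let mu_poly : {poly k} := ('X^(l.-1.+1) - 1)%R.

Definition mu_enum : seq mu :=
  pmap insub (undup (sval (closed_field_poly_normal mu_poly))).

Fact mu_enumP : Finite.axiom mu_enum.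
Proof.
apply: Finite.uniq_enumP; first by apply: pmap_sub_uniq; exact: undup_uniq.
move=> x; rewrite mem_pmap_sub mem_undup.
case: closed_field_poly_normal => r /= def_r.
have c0 : (lead_coef mu_poly != 0)%R.
  by rewrite lead_coef_eq0 -size_poly_eq0 size_XnsubC.
rewrite -root_prod_XsubC -(rootZ _ _ c0) -def_r rootE !hornerE ?hornerXn.
by rewrite (eqP (valP x)) subrr eqxx.
Qed.

Fact mu_pickleK : pcancel (index^~ mu_enum) (onth mu_enum).
Proof.
move=> x; apply/eqP; rewrite onthE (nth_map x) ?nth_index //.
all: by rewrite ?index_mem -has_pred1 has_count mu_enumP.
Qed.

HB.instance Definition _ : isCountable mu := PCanIsCountable mu_pickleK.
HB.instance Definition _ := isFinite.Build mu mu_enumP.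

Fact mu_mul_subproof (x y : mu) : is_mu (val x * val y)%R.
Proof. by rewrite /is_mu exprMn (eqP (valP x)) (eqP (valP y)) mulr1. Qed.

Fact mu_one_subproof : is_mu 1%R.
Proof. by rewrite /is_mu expr1n. Qed.

Fact mu_inv_subproof (x : mu) : is_mu (val x)^-1%R.
Proof. by rewrite /is_mu exprVn (eqP (valP x)) invr1. Qed.

Definition mu_mul x y : mu := Sub (val x * val y)%R (mu_mul_subproof x y).
Definition mu_one : mu := Sub 1%R mu_one_subproof.
Definition mu_inv x : mu := Sub (val x)^-1%R (mu_inv_subproof x).

Fact mu_mulA : associative mu_mul.
Proof. by move=> x y z; apply: val_inj; rewrite /= mulrA. Qed.

Fact mu_mul1 : left_id mu_one mu_mul.
Proof. by move=> x; apply: val_inj; rewrite /= mul1r. Qed.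

Fact mu_mulV : left_inverse mu_one mu_inv mu_mul.
Proof.
move=> x; apply: val_inj; rewrite /= mulVf //; apply/eqP => x0.
by have := valP x; rewrite /is_mu [val x]x0 expr0n eq_sym oner_eq0.
Qed.

HB.instance Definition _ := Finite_isGroup.Build mu mu_mulA mu_mul1 mu_mulV.

(* mu_n as a subgroup of mu_l, for n dividing l. *)
Definition mu_sub (n : nat) : {set mu} := 'Ldiv_n().

Lemma mu_abelian (A : {set mu}) : abelian A.
Proof.
by apply/centsP => x _ y _; apply: val_inj; rewrite /= [LHS]mulrC.
Qed.

Lemma mu_sub_group_set n : group_set (mu_sub n).
Proof. by have := group_Ldiv n (mu_abelian setT); rewrite setTI. Qed.
Canonical mu_sub_group n := Group (mu_sub_group_set n).

End RootsOfUnity.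

(* Finite multigraphs, loops allowed.  A dart is an oriented edge, i.e. a
   branch of a node, and head e = e_+ is the component carrying the branch e. *)
Record graph := Graph {
  vertex : finType;
  dart : finType;
  head : dart -> vertex;
  bar : dart -> dart;
  barK : involutive bar;
  bar_neq : forall e, bar e != e }.

Section Graphs.
Variable G : graph.

Definition tail (e : dart G) : vertex G := head (bar e).
Definition n_edges : nat := #|dart G|./2.
Definition valence (v : vertex G) : nat := #|[set e : dart G | head e == v]|.

(* An edge is contracted when one of its two orientations lies in F. *)
Definition contracted (F : pred (dart G)) (e : dart G) : bool :=
  F e || F (bar e).

Definition adj (F : pred (dart G)) : rel (vertex G) :=
  [rel v w | [exists e, [&& contracted F e, head e == v & tail e == w]]].

Definition connected : Prop :=
  (0 < #|vertex G|)%N /\ forall v w : vertex G, connect (adj predT) v w.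

Lemma contracted_bar F e : contracted F (bar e) = contracted F e.
Proof. by rewrite /contracted barK orbC. Qed.

Lemma adj_sym F : symmetric (adj F).
Proof.
move=> v w; apply/existsP/existsP => -[e /and3P[Fe he te]]; exists (bar e);
  by rewrite contracted_bar Fe /tail barK he te.
Qed.

Lemma adj_connect_sym F : connect_sym (adj F).
Proof. exact: sym_connect_sym (adj_sym F). Qed.

(* The contraction of G along F: its vertices are the connected components of
   the graph formed by the contracted edges (each represented by its root),
   and its darts are the remaining ones. *)
Section Contraction.
Variable F : pred (dart G).

Definition cvertex := {v : vertex G | roots (adj F) v}.
Definition cdart := {e : dart G | ~~ contracted F e}.

Definition chead (e : cdart) : cvertex :=
  Sub (fingraph.root (adj F) (head (val e))) (roots_root (adj_connect_sym F) (head (val e))).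

Fact cbar_subproof (e : cdart) : ~~ contracted F (bar (val e)).
Proof. by rewrite contracted_bar (valP e). Qed.

Definition cbar (e : cdart) : cdart := Sub (bar (val e)) (cbar_subproof e).

Fact cbarK : involutive cbar.
Proof. by move=> e; apply: val_inj; rewrite /= barK. Qed.

Fact cbar_neq e : cbar e != e.
Proof. by rewrite -val_eqE bar_neq. Qed.

Definition contraction : graph := @Graph cvertex cdart chead cbar cbarK cbar_neq.

End Contraction.

Section Cochains.
Variables (gT : finGroupType) (A : {set gT}).

Definition C0 : {set {dffun forall _ : vertex G, gT}} :=
  [set a : {dffun forall _ : vertex G, gT} | [forall v, a v \in A]].

Definition C1 : {set {dffun forall _ : dart G, gT}} :=
  [set b : {dffun forall _ : dart G, gT} | [forall e, b e \in A] && [forall e, b (bar e) == (b e)^-1]].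

Definition delta (a : {dffun forall _ : vertex G, gT}) :
  {dffun forall _ : dart G, gT} := [ffun e => a (head e) * (a (tail e))^-1].

End Cochains.

End Graphs.

Definition extend1 (G : graph) (F : pred (dart G)) (gT : finGroupType)
    (b : {dffun forall _ : dart (contraction F), gT}) :
    {dffun forall _ : dart G, gT} :=
  [ffun e => if insub e is Some e' then b e' else 1].

(* The combinatorial type of a level-l curve of genus g: its dual graph with,
   for every branch e, the order stab e of the stabiliser of the node and an
   integer representing the character (m mod stab e) by which the stabiliser,
   acting tautologically on the coordinate of that branch, acts on the fibre of
   the line bundle L.
   - char_coprime: the stabilisers act faithfully on the fibres;
   - stab_dvd: L^l is trivial at the nodes;
   - degree_int: L has degree 0 on every component, while the branch e
     contributes m / stab e = M(e) / l modulo the integers to that degree.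
   Conversely, for 1 <= g and l prime to the characteristic, any such datum
   comes from a level-l curve: L exists by degree_int and divisibility of the
   Pic^0 of the components, and has order exactly l after twisting by an
   l-torsion line bundle of the coarse curve. *)
Record level_graph (g l : nat) := LevelGraph {
  dual_graph :> graph;
  genus : vertex dual_graph -> nat;
  stab : dart dual_graph -> nat;
  char : dart dual_graph -> nat;
  graph_connected : connected dual_graph;
  graph_stable : forall v, (2 < 2 * genus v + valence v)%N;
  graph_genus :
    g = (\sum_v genus v + (n_edges dual_graph + 1 - #|vertex dual_graph|))%N;
  stab_dvd : forall e, (stab e %| l)%N;
  stab_bar : forall e, stab (bar e) = stab e;
  char_coprime : forall e, coprime (char e) (stab e);
  char_bar : forall e, (stab e %| char e + char (bar e))%N;
  degree_int : forall v, (l %| \sum_(e | head e == v) char e * (l %/ stab e))%N }.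

Section LevelGraph.
Variables (g l : nat) (G : level_graph g l).

(* M(e) = m l / r, as the representative in [0, l) of a class in Z/l. *)
Definition mult (e : dart G) : nat := ((char e * (l %/ stab e)) %% l)%N.

Lemma mult_bar e : (l %| mult e + mult (bar e))%N.
Proof.
rewrite /mult /dvdn modnDm stab_bar -mulnDl -/(dvdn _ _).
by rewrite -[X in (X %| _)%N](divnK (stab_dvd e)) mulnC dvdn_mul // char_bar.
Qed.

Lemma stabE e : (0 < l)%N -> stab e = (l %/ gcdn (mult e) l)%N.
Proof.
move=> l0; have r0 := dvdn_gt0 l0 (stab_dvd e).
have d0 : (0 < l %/ stab e)%N by rewrite divn_gt0 // dvdn_leq // stab_dvd.
have defl : l = (stab e * (l %/ stab e))%N by rewrite mulnC divnK // stab_dvd.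
rewrite /mult gcdn_modl [X in gcdn _ X]defl -muln_gcdl.
by rewrite (eqP (char_coprime e)) mul1n divnA ?stab_dvd // mulKn.
Qed.

(* The truncated valuation nu_p(e), None standing for infinity; for
   i <= e_p = logn p l, the class of M(e) in Z/p^e_p lies in the ideal (p^i) iff
   p^i divides M(e), and it lies in all the (p^i) iff it is zero. *)
Definition nu (p : nat) (e : dart G) : option nat :=
  if (p ^ logn p l %| mult e)%N then None
  else Some (\max_(i < logn p l | (p ^ i %| mult e)%N) i)%N.

Definition nu_ge (p j : nat) : pred (dart G) :=
  fun e => if nu p e is Some i then (j <= i)%N else true.

Lemma nu_geE p j e :
  (j <= logn p l)%N -> nu_ge p j e = (p ^ j %| mult e)%N.
Proof.
move=> le_j; rewrite /nu_ge /nu; case: ifPn => [pM | npM].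
  by rewrite (dvdn_trans (dvdn_exp2l p le_j) pM).
apply/idP/idP => [le_jm | pjM].
  have e0 : (0 < logn p l)%N.
    by rewrite lt0n; apply: contra npM => /eqP ->; rewrite expn0 dvd1n.
  pose P := [pred i : 'I_(logn p l) | p ^ i %| mult e]%N.
  have P0 : (0 < #|P|)%N.
    by apply/card_gt0P; exists (Ordinal e0); rewrite inE /= expn0 dvd1n.
  have [i pi def_i] := eq_bigmax_cond (@nat_of_ord _) P0.
  by apply: dvdn_trans pi; apply: dvdn_exp2l; rewrite -def_i.
have lt_j : (j < logn p l)%N.
  by rewrite ltn_neqAle le_j andbT; apply: contraNneq npM => <-.
exact: (@leq_bigmax_cond _ (fun i : 'I_(logn p l) => p ^ i %| mult e)%N
  (@nat_of_ord _) (Ordinal lt_j)).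
Qed.

Definition contraction_nu (p j : nat) : graph := contraction (nu_ge p j).

(* No truncation: fewer edges are contracted in the first graph. *)
Definition alpha (p j : nat) : nat :=
  (#|vertex (contraction_nu p (logn p l - j + 1))|
   - #|vertex (contraction_nu p (logn p l - j))|)%N.

(* V_p, the disjoint union of the V(nu_p^j) for 1 <= j <= e_p. *)
Definition vertex_union (p : nat) : finType :=
  {j : 'I_(logn p l) & vertex (contraction_nu p j.+1)}.

Variable k : closedFieldType.

Definition C1_nu : {set {dffun forall _ : dart G, mu k l}} :=
  [set b : {dffun forall _ : dart G, mu k l} in C1 G setT | [forall e, b e \in mu_sub k l (stab e)]].

(* G_nu(Gamma; mu_l) *)
Definition ghost_group : {set {dffun forall _ : dart G, mu k l}} :=
  C1_nu :&: @delta G (mu k l) @: C0 G setT.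

Definition im_delta_nu (p j : nat) : {set {dffun forall _ : dart G, mu k l}} :=
  @extend1 G (nu_ge p j) (mu k l) @:
    (@delta (contraction_nu p j) (mu k l) @:
       C0 (contraction_nu p j) (mu_sub k l (p ^ (logn p l - j + 1)))).

Lemma ghost_group_set : group_set ghost_group.
Proof.
have muC (x y : mu k l) : x * y = y * x.
  by apply: (centsP (mu_abelian [set: mu k l])); rewrite inE.
apply/group_setP; split=> [|b c].
  rewrite !inE; apply/andP; split.
    apply/andP; split; last by apply/forallP => e; rewrite ffunE group1.
    by apply/andP; split; apply/forallP => e; rewrite !ffunE ?inE // invg1.
  apply/imsetP; exists 1; first by rewrite inE; apply/forallP => v; rewrite inE.
  by apply/ffunP => e; rewrite !ffunE invg1 mulg1.
rewrite !inE => /andP[/andP[/andP[_ /forallP bN] /forallP bM] /imsetP[a _ ab]].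
case/andP=> /andP[/andP[_ /forallP cN] /forallP cM] /imsetP[d _ dc].
apply/andP; split.
  apply/andP; split; last by apply/forallP => e; rewrite ffunE groupM.
  apply/andP; split; apply/forallP => e; rewrite !ffunE ?inE //.
  by rewrite (eqP (bN e)) (eqP (cN e)) invMg muC.
apply/imsetP; exists (a * d); first by rewrite inE; apply/forallP => v; rewrite inE.
apply/ffunP => e; rewrite ab dc !ffunE invMg -!mulgA; congr (_ * _).
by rewrite [RHS]mulgA [RHS]muC.
Qed.
Canonical ghost_group_group := Group ghost_group_set.

End LevelGraph.

(* Main.v *)
Require Import Defs.
From mathcomp Require Import all_boot all_order all_fingroup all_algebra all_solvable.
From mathcomp Require Import zify separable cyclotomic.
Set Implicit Arguments.
Unset Strict Implicit.
Unset Printing Implicit Defensive.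

Import GroupScope GRing.Theory Defs.

(** The ghost group is abelian and killed by l, so it is the direct product of
its subgroups [primary p] of elements killed by p^e, where p runs over the
primes dividing l and e = [logn p l]; everything happens inside one of these.

Fix p.  For every j let [rep j v] be the canonical representative of the
connected component of v in the graph formed by the edges d with
nu_p(d) >= j.  Functions on the vertices of the j-th contraction are the
functions of the form [f (rep j v)].  An element of [primary p] has a potential
a with values in mu_(p^e), and a can be normalised to be trivial at the single
representative of level 0.  The condition that [delta a d] lies in
mu_(stab d) for all d says exactly that, for all j, the variation of a on an
edge with nu_p >= j is killed by p^(e - j), hence so is its variation on a component of level j
([potential_diff_torsion]).  At level e, a is constant on the components.
Therefore the trivial identity

   a v = \prod_(0 <= j < e) a (rep j.+1 v) / a (rep j v)

holds, and its j-th factor is a function of [rep j.+1 v] with values in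
mu_(p^(e - j)): this writes [delta a] as a product of elements of the
[im_delta_nu p j.+1] ([prod_im_delta_nu]).

The same identity gives coordinates.  The representatives are the first
elements of their components in a fixed enumeration of the vertices, so they
are nested: a representative of level j is still one at level j.+1.  The j-th
factor above is trivial at the representatives of level j, and its values at
those that are new at level j.+1 can be prescribed arbitrarily in
mu_(p^(e - j)).  These values determine the potential, multiplicatively
([isog_primary]), whence the group structure; the order follows by summation
by parts ([sum_weighted_diff]). *)

(** * Finite abelian groups *)

Lemma expg_gcd (gT : finGroupType) (x : gT) m n :
  x ^+ m = 1 -> x ^+ n = 1 -> x ^+ gcdn m n = 1.
Proof.
by move=> /eqP xm /eqP xn; apply/eqP; rewrite -order_dvdn dvdn_gcd !order_dvdn xm.
Qed.

Lemma expg_dvd (gT : finGroupType) (x : gT) m n :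
  m %| n -> x ^+ m = 1 -> x ^+ n = 1.
Proof.
by move=> mn /eqP xm; apply/eqP; rewrite -order_dvdn (dvdn_trans _ mn) ?order_dvdn.
Qed.

(** The Sylow decomposition of A, indexed by the primes of a multiple n of the
exponent: the primes of n that do not divide the order of A contribute trivial
factors. *)
Lemma abelian_dprod_Ldiv (gT : finGroupType) (A : {group gT}) (n : nat) :
    (0 < n)%N -> abelian A -> {in A, forall x, x ^+ n = 1} ->
  \big[dprod/1]_(p <- primes n) 'Ldiv_(p ^ logn p n)(A) = A.
Proof.
move=> n_gt0 cAA An; have nilA := abelian_nil cAA.
have LdivE p : p \in primes n -> 'Ldiv_(p ^ logn p n)(A) = 'O_p(A).
  rewrite mem_primes => /and3P[p_pr _ _].
  apply/setP=> x; rewrite !inE; have [Ax | notAx] /= := boolP (x \in A); last first.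
    by apply/esym/negbTE; apply: contra notAx; apply/subsetP/pcore_sub.
  rewrite (mem_Hall_pcore (nilpotent_pcore_Hall p nilA)) // -order_dvdn /p_elt.
  apply/idP/idP => [x_pe | x_p]; first by apply: pnat_dvd x_pe _; rewrite pnatX pnat_id.
  rewrite -p_part -(part_pnat_id x_p); apply: partn_dvd n_gt0 _.
  by rewrite order_dvdn An.
rewrite (eq_big_seq (fun p : nat => 'O_p(A))) //.
rewrite -[RHS](nilpotent_Fitting nilA) /Fitting.
have sAn p : p \in primes #|A| -> p \in primes n.
  rewrite mem_primes => /and3P[p_pr _ /(Cauchy p_pr)[x Ax ox]].
  by rewrite mem_primes p_pr n_gt0 -ox order_dvdn An ?eqxx.
rewrite (bigID (mem (primes #|A|))) /= [X in dprod _ X]big1 ?dprodg1 => [|p pA].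
  rewrite -big_filter; apply: perm_big; apply: uniq_perm.
  - by rewrite filter_uniq ?primes_uniq.
  - exact: primes_uniq.
  by move=> p; rewrite mem_filter andb_idr //; apply: sAn.
apply/eqP; rewrite trivg_card1 (card_Hall (nilpotent_pcore_Hall p nilA)) p_part.
by move: pA; rewrite -logn_gt0 lt0n negbK => /eqP ->.
Qed.

(** Stated for values in an abelian subgroup because the commutative big-operator
lemmas need a commutative law on the whole type. *)
Lemma prodgM (gT : finGroupType) (A : {group gT}) (I : eqType) (r : seq I)
    (F F' : I -> gT) :
    abelian A -> {in r, forall i, F i \in A} -> {in r, forall i, F' i \in A} ->
  \prod_(i <- r) (F i * F' i) = (\prod_(i <- r) F i) * \prod_(i <- r) F' i.
Proof.
move=> cAA; elim: r => [|i r IHr] AF AF'; first by rewrite !big_nil mulg1.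
have AFr : {in r, forall j, F j \in A} by move=> j rj; rewrite AF ?inE ?rj ?orbT.
have AFr' : {in r, forall j, F' j \in A} by move=> j rj; rewrite AF' ?inE ?rj ?orbT.
rewrite !big_cons IHr // -!mulgA; congr (_ * _); rewrite !mulgA; congr (_ * _).
apply: (centsP cAA); first by rewrite AF' ?mem_head.
by rewrite big_seq group_prod.
Qed.

Lemma isog_bigdprod (I : finType) (gT : finGroupType) (dT : I -> finGroupType)
    (H : I -> {group gT}) (A : {group gT}) :
    abelian A -> \big[dprod/1]_i H i = A ->
    (forall i, H i \isog [set: dT i]) ->
  A \isog [set: {dffun forall i, dT i}].
Proof.
move=> cAA defA isoH; rewrite isog_sym.
have ex_f i : exists f : {morphism [set: dT i] >-> gT}, 'injm f /\ f @* [set: dT i] = H i.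
  have /isogP[g inj_g im_g] : [set: dT i]%G \isog H i by rewrite isog_sym.
  by exists g.
have [f /all_and2[inj_f im_f]] := fin_all_exists ex_f.
have fH i x : f i x \in H i by rewrite -im_f mem_morphim ?inE.
have sHA i : H i \subset A by rewrite -(bigdprodWY defA) sub_gen // (bigcup_max i).
have fA i x : f i x \in A := subsetP (sHA i) _ (fH i x).
pose F (x : {dffun forall i, dT i}) := \prod_i f i (x i).
have FM : {in [set: {dffun forall i, dT i}] &, {morph F : x y / x * y}}.
  move=> x y _ _; rewrite /F -(prodgM cAA) //.
  by apply: eq_bigr => i _; rewrite ffunE morphM ?inE.
apply/isogP; exists (Morphism FM).
  apply/injmP => x y _ _ /= Fxy; apply/ffunP => i.
  have Ax : F x \in A by apply: group_prod.
  have [c [_ _ cU]] := mem_bigdprod defA Ax.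
  apply: (injmP (inj_f i)); rewrite ?inE //.
  by rewrite (cU (fun i => f i (x i))) // (cU (fun i => f i (y i))).
apply/setP => a; apply/morphimP/idP => [[x _ _ ->] | Aa].
  by apply: group_prod => i _; apply: fA.
have [c [Hc -> _]] := mem_bigdprod defA Aa.
have ex_x i : exists x, f i x = c i.
  have /morphimP[x _ _ ->] : c i \in f i @* [set: dT i] by rewrite im_f Hc.
  by exists x.
have [x fx] := fin_all_exists ex_x.
exists [ffun i => x i : dT i]; rewrite ?inE //=.
by apply: eq_bigr => i _; rewrite ffunE fx.
Qed.

Lemma expg_ffun (I : finType) (gT : I -> finGroupType)
    (x : {dffun forall i, gT i}) n i :
  (x ^+ n) i = x i ^+ n.
Proof. by elim: n => [|n IHn]; rewrite ?oneg_ffun // !expgS mulg_ffun IHn. Qed.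
(** * Summation by parts *)

(** Abel summation.  Here N i will be the number of vertices of the i-th
contraction, so that N 0 = 1 and the first sum is the exponent of p in the order
of the product of N (n - j) - N (n - j - 1) copies of each mu_(p^(j+1)). *)
Lemma sum_weighted_diff (N : nat -> nat) n : {homo N : i j / (i <= j)%N} ->
  (\sum_(j < n) j.+1 * (N (n - j) - N (n - j.+1)) + n * N 0)%N = (\sum_(j < n) N j.+1)%N.
Proof.
move=> N_mono; elim: n => [|n IHn]; first by rewrite !big_ord0.
rewrite [RHS]big_ord_recr /= -IHn [X in (X + _)%N]big_ord_recl /= subn0 subSS subn0.
under eq_bigr do rewrite /bump add1n !subSS.
have -> : (\sum_(i < n) i.+2 * (N (n - i) - N (n - i.+1)) =
   \sum_(i < n) i.+1 * (N (n - i) - N (n - i.+1)) + (N n - N 0))%N.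
  under eq_bigr do rewrite mulSn addnC.
  rewrite big_split /=; congr addn.
  rewrite -(telescope_sumn 0 n N_mono) big_mkord (reindex_inj rev_ord_inj) /=.
  by apply: eq_bigr => i _; have iE := ltn_ord i; congr (N _ - N _)%N; lia.
have := N_mono 0 n (leq0n _); have := N_mono n n.+1 (leqnSn _).
rewrite mul1n mulSn; move: (\sum_(i < n) _)%N => S; move: (n * N 0)%N => T.
by lia.
Qed.

(** * Roots of unity *)

Section RootsOfUnity.
Variable k : closedFieldType.

Lemma is_muE n (x : k) : (0 < n)%N -> is_mu n x = (x ^+ n == 1)%R.
Proof. by case: n. Qed.

Lemma val_mu_root l (x : mu k l) : (0 < l)%N -> (val x ^+ l = 1)%R.
Proof. by move=> l_gt0; apply/eqP; rewrite -is_muE // (valP x). Qed.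

Lemma card_mu (n : nat) :
  (0 < n)%N -> (forall p, p \in [pchar k]%R -> coprime p n) -> #|{: mu k n}| = n.
Proof.
move=> n_gt0 n_pchar.
have n_neq0 : (n%:R != 0 :> k)%R.
  rewrite natf_neq0_pchar /pnat n_gt0; apply/allP => p.
  rewrite mem_primes => /and3P[p_pr _ pn]; apply/negP => /n_pchar.
  by rewrite prime_coprime // pn.
have [r def_r] := closed_field_poly_normal ('X^n - 1 : {poly k})%R.
rewrite lead_coefXnsubC // scale1r in def_r.
have r_uniq : uniq r.
  by rewrite -separable_prod_XsubC -def_r separable_Xn_sub_1.
have size_r : size r = n.
  by apply/eqP; rewrite -eqSS -(size_prod_XsubC r id) -def_r size_XnsubC.
rewrite cardT -[RHS]size_r -(size_map val); apply: perm_size; apply: uniq_perm => //.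
  by rewrite (map_inj_uniq val_inj) enum_uniq.
move=> x; rewrite -[RHS]root_prod_XsubC -def_r rootE !hornerE subr_eq0.
apply/mapP/idP => [[y _ ->] | xn].
  by rewrite val_mu_root.
have mux : is_mu n x by rewrite is_muE.
by exists (Sub x mux); rewrite ?mem_enum ?SubK.
Qed.

Lemma mu_mulC l (x y : mu k l) : x * y = y * x.
Proof. by apply: (centsP (mu_abelian [set: mu k l])); rewrite inE. Qed.

Lemma val_muX l (x : mu k l) n : val (x ^+ n) = (val x ^+ n)%R.
Proof. by elim: n => // n IHn; rewrite expgS exprS -IHn. Qed.

Lemma mu_expg l (x : mu k l) : (0 < l)%N -> x ^+ l = 1.
Proof.
move=> l_gt0; apply: val_inj; rewrite val_muX.
exact: val_mu_root.
Qed.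

Lemma mu_telescope l n (h : nat -> mu k l) :
  \prod_(j < n) (h j.+1 * (h j)^-1) = h n * (h 0%N)^-1.
Proof.
elim: n => [|n IHn]; first by rewrite big_ord0 mulgV.
by rewrite big_ord_recr /= IHn [LHS]mu_mulC mulgA mulgKV.
Qed.

(** The inclusion of mu_m into mu_n when m divides n; in the other direction it
sends to mu_n those elements of mu_m that are killed by n, and is only
meaningful on these. *)
Definition mu_cast m n (x : mu k m) : mu k n := insubd (1 : mu k n) (val x).

Lemma val_mu_cast m n (x : mu k m) :
  (0 < n)%N -> (x ^+ n = 1) -> val (mu_cast n x) = val x.
Proof.
by move=> n_gt0 xn; rewrite val_insubd is_muE // -val_muX xn eqxx.
Qed.

Lemma mu_castM m n : (0 < m)%N -> (0 < n)%N -> m %| n ->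
  {morph @mu_cast m n : x y / x * y}.
Proof.
move=> m_gt0 n_gt0 mn x y; have castE (z : mu k m) : val (mu_cast n z) = val z.
  by apply: val_mu_cast => //; apply: expg_dvd mn _; apply: mu_expg.
by apply: val_inj; rewrite /= !castE.
Qed.

Lemma mu_castX m n (x : mu k m) : (0 < m)%N -> (0 < n)%N -> m %| n ->
  mu_cast n x ^+ m = 1.
Proof.
move=> m_gt0 n_gt0 mn; apply: val_inj; rewrite val_muX val_mu_cast //.
  by rewrite -val_muX mu_expg.
by apply: expg_dvd mn _; apply: mu_expg.
Qed.

Lemma mu_castK m n (x : mu k m) : (0 < n)%N -> x ^+ n = 1 ->
  mu_cast m (mu_cast n x) = x.
Proof.
move=> n_gt0 xn; apply: val_inj.
by rewrite val_insubd val_mu_cast // (valP x).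
Qed.

Lemma mu_cast1 m n : mu_cast n (1 : mu k m) = 1.
Proof. by apply: val_inj; rewrite val_insubd /= if_same. Qed.

End RootsOfUnity.

(** * Nested systems of representatives *)

(** [pick] returns the first element satisfying a predicate in a fixed
enumeration, so it is still the first one among any smaller set containing
it. *)
Lemma pick_subpred (T : finType) (P Q : pred T) x :
  subpred Q P -> Q x -> pick P = Some x -> pick Q = Some x.
Proof.
move=> sQP Qx; rewrite /pick /enum_mem; elim: (Finite.enum T) => //= y s IHs.
rewrite -!topredE /=; have [Py | nPy] := boolP (P y); first by move=> [->]; rewrite Qx.
by move/IHs; case: ifPn => // /sQP; rewrite (negPf nPy).
Qed.

Section NestedRoots.
Variables (T : finType) (e e' : rel T).
Hypothesis e_sym : connect_sym e.
(* e' has the finer components. *)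
Hypothesis sub_e : subrel e' e.

Lemma sub_connect_rel : subrel (connect e') (connect e).
Proof. by apply: connect_sub => x y /sub_e; apply: connect1. Qed.

Lemma root_coarse x : fingraph.root e (fingraph.root e' x) = fingraph.root e x.
Proof.
by apply/esym/(fingraph.rootP e_sym); apply: sub_connect_rel; apply: connect_root.
Qed.

(** The reason why representatives of the coarse components are also
representatives of the fine ones: a root is the first element of its
component. *)
Lemma root_fine x : fingraph.root e' (fingraph.root e x) = fingraph.root e x.
Proof.
have pick_x : pick (connect e x) = Some (fingraph.root e x).
  by rewrite /fingraph.root; case: pickP => //= /(_ x); rewrite connect0.
rewrite {1}/fingraph.root (pick_subpred _ _ pick_x) // => z /sub_connect_rel.
exact: connect_trans (connect_root _ _).
Qed.

End NestedRoots.

(** * Cochains on a graph *)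

Section GraphCochains.
Variable G : graph.

Lemma connect_const (F : pred (dart G)) (T : Type) (f : vertex G -> T) :
    (forall e, contracted F e -> f (head e) = f (tail e)) ->
  forall v w, connect (adj F) v w -> f v = f w.
Proof.
move=> fF v w /connectP[s]; elim: s v => [|u s IHs] v /=; first by move=> _ ->.
by case/andP=> /existsP[e /and3P[Fe /eqP<- /eqP<-]] /IHs{}IHs /IHs <-; apply: fF.
Qed.

Lemma root_head (F : pred (dart G)) (e : dart G) :
  contracted F e ->
  fingraph.root (adj F) (head e) = fingraph.root (adj F) (tail e).
Proof.
move=> Fe; apply/(fingraph.rootP (adj_connect_sym F))/connect1.
by apply/existsP; exists e; rewrite Fe !eqxx.
Qed.

Section AbelianCoefficients.
Variable gT : finGroupType.
Hypothesis cgT : abelian [set: gT].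
Implicit Types a : {dffun forall _ : vertex G, gT}.

Let gC (x y : gT) : x * y = y * x. Proof. by apply: (centsP cgT); rewrite inE. Qed.

Lemma deltaM : {morph @delta G gT : a a' / a * a'}.
Proof.
move=> a a'; apply/ffunP => e; rewrite !ffunE invMg -!mulgA; congr (_ * _).
by rewrite mulgA; apply: gC.
Qed.

Lemma delta1 : @delta G gT 1 = 1.
Proof. by apply/ffunP => e; rewrite !ffunE mulgV. Qed.

Lemma deltaX a n : delta (a ^+ n) = delta a ^+ n.
Proof. by elim: n => [|n IHn]; rewrite ?expg0 ?delta1 // !expgS deltaM IHn. Qed.

Lemma delta_bar a e : delta a (bar e) = (delta a e)^-1.
Proof. by rewrite !ffunE invMg invgK /tail barK. Qed.

Lemma delta_eq1 a : connected G -> delta a = 1 -> forall v w, a v = a w.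
Proof.
move=> [_ G_conn] da1 v w; apply: connect_const (G_conn v w) => e _.
by apply/eqP; rewrite eq_mulgV1; move/ffunP/(_ e): da1; rewrite !ffunE => ->.
Qed.

(** Coboundaries on a contraction are the coboundaries of the functions that
are constant on the contracted components. *)
Lemma extend1_delta (F : pred (dart G))
    (c : {dffun forall _ : vertex (contraction F), gT}) :
  extend1 (delta c) =
    delta [ffun v => c (Sub (fingraph.root (adj F) v)
                            (roots_root (adj_connect_sym F) v))].
Proof.
apply/ffunP => e; rewrite !ffunE; case: insubP => [e' _ def_e | ].
  rewrite ffunE -def_e; congr (c _ * (c _)^-1); exact: val_inj.
rewrite negbK => Fe.
rewrite [X in _ = X * _](_ : _ = c (Sub (fingraph.root (adj F) (tail e))
   (roots_root (adj_connect_sym F) (tail e)))) ?mulgV //.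
by congr (c _); apply: val_inj; rewrite /= root_head.
Qed.

End AbelianCoefficients.
End GraphCochains.

(** * The p-primary part of the ghost group *)

Section PrimaryPart.
Variables (k : closedFieldType) (g l : nat) (G : level_graph g l) (p : nat).
Hypotheses (l_gt0 : (0 < l)%N) (p_l : p \in primes l).

Let E := logn p l.
Let p_pr : prime p. Proof. by move: p_l; rewrite mem_primes => /and3P[]. Qed.
Let p_gt0 : (0 < p)%N := prime_gt0 p_pr.
Let E_gt0 : (0 < E)%N. Proof. by rewrite logn_gt0. Qed.
Let muA := mu_abelian [set: mu k l].

Lemma dvdn_pexp_l j : j <= E -> p ^ j %| l.
Proof. by move=> le_jE; rewrite (dvdn_trans (dvdn_exp2l p le_jE)) ?pfactor_dvdnn. Qed.

(** M(e) and M(bar e) are opposite modulo l, so one orientation suffices to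
decide whether an edge is contracted. *)
Lemma contracted_nu j (e : dart G) :
  j <= E -> contracted (nu_ge p j) e = (p ^ j %| mult e).
Proof.
move=> le_jE; rewrite /contracted !nu_geE //; apply: orb_idr => pj_bar.
rewrite -(dvdn_addl _ pj_bar); exact: dvdn_trans (dvdn_pexp_l le_jE) (mult_bar e).
Qed.

Lemma stab_mul_gcd (e : dart G) : (stab e * gcdn (mult e) l)%N = l.
Proof. by rewrite (stabE e l_gt0) divnK // dvdn_gcdr. Qed.

(** Both this lemma and the next one read the p-adic valuation of the
stabiliser off the identity [stab_mul_gcd]. *)
Lemma gcd_stab_contracted j (e : dart G) : j <= E ->
  contracted (nu_ge p j) e -> gcdn (stab e) (p ^ E) %| p ^ (E - j).
Proof.
move=> le_jE; rewrite contracted_nu // => pj_e.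
have /(dvdn_pfactor _ _ p_pr)[i _ def_i] : gcdn (stab e) (p ^ E) %| p ^ E by apply: dvdn_gcdr.
rewrite def_i dvdn_exp2l // leq_subRL // -pfactor_dvdn // expnD -(stab_mul_gcd e) mulnC.
by rewrite dvdn_mul // -?def_i ?dvdn_gcdl // dvdn_gcd pj_e dvdn_pexp_l.
Qed.

Lemma dvdn_stab_not_contracted j (e : dart G) : j <= E ->
  ~~ contracted (nu_ge p j) e -> p ^ (E - j + 1) %| stab e.
Proof.
move=> le_jE; rewrite contracted_nu // => npj_e.
have gcd_gt0 : 0 < gcdn (mult e) l by rewrite gcdn_gt0 l_gt0 orbT.
have stab_gt0 : 0 < stab e by apply: dvdn_gt0 l_gt0 (stab_dvd e).
have lt_j : logn p (gcdn (mult e) l) < j.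
  by rewrite ltnNge -pfactor_dvdn // dvdn_gcd (negPf npj_e).
have : E = (logn p (stab e) + logn p (gcdn (mult e) l))%N by rewrite -lognM // stab_mul_gcd.
rewrite pfactor_dvdn //; lia.
Qed.

Definition rep j (v : vertex G) : vertex G := fingraph.root (adj (nu_ge p j)) v.

Lemma adj_nu_anti i j : i <= j -> subrel (adj (nu_ge p j)) (@adj G (nu_ge p i)).
Proof.
move=> le_ij v w /existsP[e /and3P[je he te]]; apply/existsP; exists e.
rewrite he te !andbT; move: je; rewrite /contracted /nu_ge.
by case/orP; case: (nu p _) => [m /(leq_trans le_ij)->|_]; rewrite ?orbT.
Qed.

Lemma rep_coarse i j v : i <= j -> rep i (rep j v) = rep i v.
Proof. move=> /adj_nu_anti/(root_coarse (adj_connect_sym _)); exact. Qed.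

Lemma rep_fine i j v : i <= j -> rep j (rep i v) = rep i v.
Proof. move=> /adj_nu_anti/root_fine; exact. Qed.

(** Every edge is contracted at level 0, and the graph is connected. *)
Lemma rep0 v w : rep 0 v = rep 0 w.
Proof.
apply/(fingraph.rootP (adj_connect_sym _)).
have [_ /(_ v w)] := graph_connected G; apply: connect_sub => {v w} v w.
case/existsP=> e /and3P[_ he te]; apply/connect1/existsP; exists e.
by rewrite he te !andbT /contracted /nu_ge; case: (nu p e).
Qed.

Lemma rep_head j e : contracted (nu_ge p j) e -> rep j (head e) = rep j (tail e).
Proof. exact: root_head. Qed.

Definition pullback j (f : vertex G -> mu k l) :
  {dffun forall _ : vertex G, mu k l} := [ffun v => f (rep j v)].

Lemma im_delta_nuP j (b : {dffun forall _ : dart G, mu k l}) :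
  reflect (exists2 f, forall v, f v ^+ (p ^ (E - j + 1)) = 1 & b = delta (pullback j f))
          (b \in im_delta_nu G k p j).
Proof.
apply: (iffP imsetP) => [[_ /imsetP[c c0 ->] ->] | [f f0 ->]].
  pose f v := if insub v is Some w then c w else 1.
  exists f => [v | ].
    rewrite /f; case: insubP => [w _ _ | _]; last by rewrite expg1n.
    by move: c0; rewrite inE => /forallP/(_ w); rewrite !inE => /eqP.
  rewrite extend1_delta; congr delta; apply/ffunP => v; rewrite !ffunE /f.
  rewrite insubT => [|w_root]; first exact/roots_root/adj_connect_sym.
  by congr (c _); apply: val_inj.
pose c : {dffun forall _ : vertex (contraction_nu G p j), mu k l} := [ffun v => f (val v)].
exists (delta c).
  apply: imset_f; rewrite inE; apply/forallP => v; rewrite !inE ffunE.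
  by apply/eqP/f0.
by rewrite extend1_delta; congr delta; apply/ffunP => v; rewrite !ffunE.
Qed.

Lemma ghost_groupP (b : {dffun forall _ : dart G, mu k l}) :
  reflect (exists2 a, forall e, delta a e ^+ stab e = 1 & b = delta a)
          (b \in ghost_group G k).
Proof.
apply: (iffP idP) => [/setIP[b_nu /imsetP[a _ def_b]] | [a a_nu ->]].
  exists a => // e; move: b_nu; rewrite def_b 2!inE => /andP[_ /forallP/(_ e)].
  by rewrite !inE => /eqP.
rewrite inE imset_f ?andbT; last by rewrite inE; apply/forallP => v; rewrite inE.
rewrite !inE; apply/andP; split; last by apply/forallP => e; rewrite !inE a_nu eqxx.
by apply/andP; split; apply/forallP => e; rewrite ?inE // delta_bar.
Qed.

Lemma ghost_group_abelian : abelian (ghost_group G k).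
Proof.
apply/centsP => b _ c _; apply/ffunP => e; rewrite !ffunE; exact: mu_mulC.
Qed.

Definition primary : {set {dffun forall _ : dart G, mu k l}} :=
  'Ldiv_(p ^ E)(ghost_group G k).

Lemma primary_group_set : group_set primary.
Proof. exact: group_Ldiv ghost_group_abelian. Qed.
Canonical primary_group := Group primary_group_set.

(** An edge that survives at level j has a stabiliser of order divisible by
p^(e - j + 1), so the condition defining the ghost group holds on it. *)
Lemma im_delta_nu_sub_primary j :
  0 < j <= E -> im_delta_nu G k p j \subset primary.
Proof.
case/andP=> j_gt0 le_jE; apply/subsetP => _ /im_delta_nuP[f f_tors ->].
apply/setIP; split; last first.
  rewrite inE -deltaX // -(delta1 G (mu k l)); apply/eqP; congr delta.
  apply/ffunP => v; rewrite expg_ffun oneg_ffun ffunE.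
  by apply: expg_dvd (f_tors _); rewrite dvdn_exp2l //; lia.
apply/ghost_groupP; exists (pullback j f) => // e.
have [je | nje] := boolP (contracted (nu_ge p j) e).
  by rewrite !ffunE (rep_head je) mulgV expg1n.
apply/(expg_dvd (dvdn_stab_not_contracted le_jE nje)).
rewrite !ffunE expgMn ?expgVn; last exact: mu_mulC.
by rewrite !f_tors invg1 mulg1.
Qed.

(** The key estimate: the ghost condition bounds the variation of a potential
along each edge contracted at level j, hence across a whole component. *)
Lemma potential_diff_torsion j (a : {dffun forall _ : vertex G, mu k l}) v w :
    (forall u, a u ^+ (p ^ E) = 1) -> (forall e, delta a e ^+ stab e = 1) ->
    j <= E -> rep j v = rep j w ->
  (a v * (a w)^-1) ^+ (p ^ (E - j)) = 1.
Proof.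
move=> a_tors a_nu le_jE /(fingraph.rootP (adj_connect_sym _)).
suff a_const e : contracted (nu_ge p j) e ->
    a (head e) ^+ (p ^ (E - j)) = a (tail e) ^+ (p ^ (E - j)).
  move/(connect_const (f := fun u => a u ^+ (p ^ (E - j))) a_const).
  by rewrite expgMn ?expgVn => [->|]; [rewrite mulgV | apply: mu_mulC].
move=> je; apply/eqP; rewrite eq_mulgV1 -expgVn -expgMn; last exact: mu_mulC.
apply/eqP/(expg_dvd (gcd_stab_contracted le_jE je)).
apply: expg_gcd; first by have := a_nu e; rewrite ffunE.
by rewrite expgMn ?expgVn ?a_tors ?invg1 ?mulg1 //; apply: mu_mulC.
Qed.

(** Dividing by its value at the representative of level 0 does not change the
coboundary of a function, and makes it killed by p^e as soon as its coboundary
is: its p^e-th power is then constant and trivial somewhere. *)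
Lemma primary_potential (b : {dffun forall _ : dart G, mu k l}) : b \in primary ->
  exists a : {dffun forall _ : vertex G, mu k l},
    [/\ b = delta a, forall v, a v ^+ (p ^ E) = 1,
        forall e, delta a e ^+ stab e = 1 & forall v, a (rep 0 v) = 1].
Proof.
case/setIP=> /ghost_groupP[a0 a0_nu ->]; rewrite inE => /eqP a0_tors.
pose a : {dffun forall _ : vertex G, mu k l} := [ffun v => a0 v * (a0 (rep 0 v))^-1].
have da : delta a = delta a0.
  apply/ffunP => e; rewrite !ffunE (rep0 (tail e) (head e)) invMg invgK.
  by rewrite mulgA mulgKV.
have a_rep0 v : a (rep 0 v) = 1 by rewrite ffunE rep_fine // mulgV.
exists a; rewrite da; split=> // v.
have := a_rep0 v; move: a0_tors; rewrite -da -deltaX //.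
move/(delta_eq1 (graph_connected G))/(_ v (rep 0 v)).
by rewrite !expg_ffun => -> ->; rewrite expg1n.
Qed.

(** At level e the stabiliser has no p-part left on the contracted edges. *)
Lemma rep_top (a : {dffun forall _ : vertex G, mu k l}) v :
    (forall v, a v ^+ (p ^ E) = 1) -> (forall e, delta a e ^+ stab e = 1) ->
  a (rep E v) = a v.
Proof.
move=> a_tors a_nu; apply/eqP; rewrite eq_mulgV1 -[_ * _]expg1.
by rewrite -[1%N](expn0 p) -(subnn E) (potential_diff_torsion a_tors a_nu) // rep_fine.
Qed.

Lemma potential_telescope (a : {dffun forall _ : vertex G, mu k l}) :
    (forall v, a v ^+ (p ^ E) = 1) -> (forall e, delta a e ^+ stab e = 1) ->
    (forall v, a (rep 0 v) = 1) ->
  forall v, a v = \prod_(j < E) (a (rep j.+1 v) * (a (rep j v))^-1).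
Proof.
move=> a_tors a_nu a_rep0 v; rewrite (mu_telescope _ (fun j => a (rep j v))).
by rewrite rep_top // a_rep0 invg1 mulg1.
Qed.

(** The j-th factor of the telescoping product only depends on [rep j.+1 v] and
is killed by p^(e - j). *)
Lemma prod_im_delta_nu : \prod_(1 <= j < E.+1) im_delta_nu G k p j = primary.
Proof.
apply/eqP; rewrite eqEsubset; apply/andP; split.
  rewrite big_nat_cond; apply: (big_ind (fun B : {set _} => B \subset primary)).
  - exact: sub1G.
  - by move=> B C; apply: mul_subG.
  - by move=> j /andP[j_E _]; apply: im_delta_nu_sub_primary.
apply/subsetP => b /primary_potential[a [-> a_tors a_nu a_rep0]].
have -> : delta a = \prod_(j < E) delta (pullback j.+1 (fun v => a v * (a (rep j v))^-1)).
  rewrite -(big_morph _ (deltaM muA) (delta1 G (mu k l))); congr delta.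
  apply/ffunP => v; rewrite prodg_ffun (potential_telescope a_tors a_nu a_rep0).
  by apply: eq_bigr => j _; rewrite ffunE rep_coarse.
rewrite big_add1 big_mkord; apply: mem_prodg => j _.
apply/im_delta_nuP; exists (fun v => a v * (a (rep j v))^-1) => // v.
have -> : (E - j.+1 + 1 = E - j)%N by have := ltn_ord j; lia.
by apply: potential_diff_torsion => //; [apply: ltnW | rewrite rep_fine].
Qed.

(** * Coordinates on the p-primary part *)

Lemma card_contraction_nu j :
  #|vertex (contraction_nu G p j)| = #|[set v | rep j v == v]|.
Proof. by rewrite card_sig; apply: eq_card => v; rewrite !inE. Qed.

Lemma rep_anti i j v : i <= j -> rep i v = v -> rep j v = v.
Proof. by move=> le_ij <-; apply: rep_fine. Qed.

(** The representatives of level e - j that are not representatives of level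
e - j - 1.  The numbering of the levels is reversed so that j is the index of
the factor mu_(p^(j+1)); the level e - j is written as the successor of
e - j - 1, which agrees with it for j < e. *)
Definition new_reps j : {set vertex G} :=
  [set v | rep (E - j.+1).+1 v == v] :\: [set v | rep (E - j.+1) v == v].

Lemma card_new_reps j : #|new_reps j| = alpha G p j.+1.
Proof.
rewrite cardsD (setIidPr _) /alpha ?addn1 ?card_contraction_nu //.
by apply/subsetP => v; rewrite !inE => /eqP rep_v; apply/eqP/(rep_anti _ rep_v).
Qed.

(** The value [None] marks the vertices that are not new, since they are not in
the enumeration. *)
Definition new_index j (v : vertex G) : option 'I_(alpha G p j.+1) :=
  insub (index v (enum (new_reps j))).

Definition new_rep j (i : 'I_(alpha G p j.+1)) : vertex G :=
  enum_val (cast_ord (esym (card_new_reps j)) i).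

Lemma new_index_old j v : rep (E - j.+1) v = v -> new_index j v = None.
Proof.
move=> rep_v; rewrite /new_index insubN // -(card_new_reps j) cardE index_mem.
by rewrite mem_enum !inE rep_v eqxx.
Qed.

Lemma new_repP j i : new_rep (j := j) i \in new_reps j.
Proof. exact: enum_valP. Qed.

Lemma new_repK j : pcancel (@new_rep j) (new_index j).
Proof.
move=> i; rewrite /new_index /new_rep /enum_val index_uniq ?enum_uniq //=; last first.
  by rewrite -cardE card_new_reps.
exact: valK.
Qed.

Lemma new_indexK j : ocancel (new_index j) (@new_rep j).
Proof.
move=> v; rewrite /new_index; case: insubP => //= i v_lt def_i.
have v_new : v \in enum (new_reps j) by rewrite -index_mem -cardE card_new_reps.
by rewrite /new_rep /enum_val /= def_i nth_index.
Qed.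

Definition parameters : finGroupType :=
  {dffun forall j : 'I_E, {dffun forall _ : 'I_(alpha G p j.+1), mu k (p ^ j.+1)}}.

Implicit Types d : parameters.

(** The j-th coordinates as a function on all vertices, trivial outside the new
representatives. *)
Definition new_coef d (j : 'I_E) (v : vertex G) : mu k l :=
  if new_index j v is Some i then mu_cast l (d j i) else 1.

Definition potential d : {dffun forall _ : vertex G, mu k l} :=
  [ffun v => \prod_(j < E) new_coef d j (rep (E - j.+1).+1 v)].

Lemma pexp_gt0 j : 0 < p ^ j. Proof. by rewrite expn_gt0 p_gt0. Qed.

Lemma new_coefM j v : {morph (fun d => new_coef d j v) : d d' / d * d'}.
Proof.
move=> d d'; rewrite /new_coef; case: new_index => [i|]; last by rewrite mulg1.
by rewrite !ffunE mu_castM ?pexp_gt0 ?dvdn_pexp_l.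
Qed.

Lemma new_coef_tors d (j : 'I_E) v : new_coef d j v ^+ (p ^ j.+1) = 1.
Proof.
rewrite /new_coef; case: new_index => [i|]; last by rewrite expg1n.
by rewrite mu_castX ?pexp_gt0 ?dvdn_pexp_l.
Qed.

Lemma new_coef_old d (j : 'I_E) v : rep (E - j.+1) v = v -> new_coef d j v = 1.
Proof. by move=> v_old; rewrite /new_coef new_index_old. Qed.

Lemma potentialM : {morph potential : d d' / d * d'}.
Proof.
move=> d d'; apply/ffunP => v; rewrite !ffunE -(prodgM muA) //; last first.
- by move=> j _; rewrite inE.
- by move=> j _; rewrite inE.
by apply: eq_bigr => j _; apply: new_coefM.
Qed.

Lemma potential_rep0 d v : potential d (rep 0 v) = 1.
Proof.
by rewrite ffunE big1 // => j _; rewrite rep_fine // new_coef_old // rep_fine.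
Qed.

(** At a new representative v, the potential and its value at the component of v
one level below differ by a single factor: the coarser factors agree because
the two vertices have the same coarser representatives, and the finer ones are
trivial because neither vertex is new at a finer level. *)
Lemma potential_step d (j : 'I_E) v : v \in new_reps j ->
  potential d v = potential d (rep (E - j.+1) v) * new_coef d j v.
Proof.
rewrite !inE => /andP[_ /eqP v_new]; rewrite !ffunE.
have -> : new_coef d j v = \prod_(i < E) if i == j then new_coef d j v else 1.
  by rewrite (big_only1 j) ?eqxx // => i /negPf ->.
rewrite -(prodgM muA) => [|i _|i _]; rewrite ?inE //.
have jE := ltn_ord j; apply: eq_bigr => i _; have iE := ltn_ord i.
have v_fine m : E - j.+1 < m -> rep m v = v by move=> /rep_anti; apply.
case: (ltngtP i j) => [lt_ij | lt_ji | /val_inj ->].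
- rewrite (negPf (_ : i != j)) ?mulg1; last by rewrite -val_eqE neq_ltn lt_ij.
  have le_ji : E - j.+1 < E - i.+1 by lia.
  have le_ji1 : E - j.+1 < (E - i.+1).+1 by lia.
  rewrite (v_fine _ le_ji1) (rep_fine _ (ltnW le_ji1)) !new_coef_old //.
    by rewrite (rep_fine _ (ltnW le_ji)).
  exact: v_fine.
- rewrite (negPf (_ : i != j)) ?mulg1; last by rewrite -val_eqE neq_ltn lt_ji orbT.
  by rewrite rep_coarse //; lia.
by rewrite eqxx v_new rep_fine // [X in X * _]new_coef_old ?mul1g // rep_fine.
Qed.

Lemma new_coef_new_rep d (j : 'I_E) i : new_coef d j (new_rep i) = mu_cast l (d j i).
Proof. by rewrite /new_coef new_repK. Qed.

Lemma delta_potentialM : {in [set: parameters] &,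
  {morph (fun d => delta (potential d)) : d d' / d * d'}}.
Proof. by move=> d d' _ _; rewrite potentialM deltaM. Qed.

Definition delta_potential := Morphism delta_potentialM.

(** A potential with trivial coboundary is constant, hence trivial since it is
trivial at level 0; by [potential_step] all its coordinates are trivial. *)
Lemma injm_delta_potential : 'injm delta_potential.
Proof.
apply/subsetP => d; rewrite !inE => /eqP /= dpot1; apply/eqP.
have pot1 v : potential d v = 1.
  by rewrite (delta_eq1 (graph_connected G) dpot1 v (rep 0 v)) potential_rep0.
apply/ffunP => j; apply/ffunP => i; rewrite !oneg_ffun.
have := potential_step d (new_repP i); rewrite !pot1 mul1g new_coef_new_rep => cast1.
have dij_tors : d j i ^+ l = 1.
  by apply: expg_dvd (mu_expg _ _); rewrite ?pexp_gt0 ?dvdn_pexp_l.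
by rewrite -(mu_castK l_gt0 dij_tors) -cast1 mu_cast1.
Qed.

Lemma delta_potential_primary d : delta (potential d) \in primary.
Proof.
have -> : potential d = \prod_(j < E) pullback (E - j.+1).+1 (new_coef d j).
  by apply/ffunP => v; rewrite prodg_ffun ffunE; apply: eq_bigr => j _; rewrite ffunE.
rewrite (big_morph _ (deltaM muA) (delta1 G (mu k l))).
apply: group_prod => j _; have jE := ltn_ord j.
apply: (subsetP (@im_delta_nu_sub_primary (E - j.+1).+1 _)); first by lia.
apply/im_delta_nuP; exists (new_coef d j) => // v.
have -> : (E - (E - j.+1).+1 + 1 = j.+1)%N by lia.
exact: new_coef_tors.
Qed.

(** The coordinates of [delta a] are the factors a (rep j.+1 v) / a (rep j v)
of the telescoping product at the new representatives; the factor is trivial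
at the old ones, where the two vertices coincide. *)
Lemma primary_delta_potential b : b \in primary ->
  exists d, b = delta (potential d).
Proof.
case/primary_potential=> a [-> a_tors a_nu a_rep0].
pose c j v := a v * (a (rep (E - j.+1) v))^-1.
have c_tors (j : 'I_E) v : c j v ^+ (p ^ j.+1) = 1.
  have def_j : (E - (E - j.+1) = j.+1)%N by have := ltn_ord j; lia.
  have := potential_diff_torsion a_tors a_nu (leq_subr j.+1 E) (esym (rep_fine v (leqnn _))).
  by rewrite def_j.
pose d : parameters :=
  [ffun j : 'I_E => [ffun i => mu_cast (p ^ j.+1) (c j (new_rep i))]].
have new_coefE (j : 'I_E) v : rep (E - j.+1).+1 v = v -> new_coef d j v = c j v.
  move=> rep_v; have [v_old | v_new] := eqVneq (rep (E - j.+1) v) v.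
    by rewrite new_coef_old // /c v_old mulgV.
  rewrite /new_coef; have := new_indexK j v; case def_i: (new_index j v) => [i|] /= def_v.
    by rewrite !ffunE def_v mu_castK ?pexp_gt0.
  have v_in : v \in enum (new_reps j) by rewrite mem_enum !inE v_new rep_v eqxx.
  move: def_i; rewrite /new_index insubT ?(card_new_reps j) //.
  by rewrite -(card_new_reps j) cardE index_mem.
exists d; congr delta; apply/ffunP => v; rewrite ffunE.
(* The telescoping product in reversed order, as potentials are indexed. *)
pose h j := (a (rep (E - j) v))^-1.
transitivity (h E * (h 0%N)^-1).
  by rewrite /h subnn subn0 a_rep0 rep_top // invgK invg1 mul1g.
rewrite -(mu_telescope E h); apply: eq_bigr => j _; have jE := ltn_ord j.
have -> : (E - j.+1).+1 = (E - j)%N by lia.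
rewrite new_coefE; first by rewrite /c /h invgK mu_mulC rep_coarse // leq_sub2l.
by rewrite subnSK // rep_fine.
Qed.

Lemma isog_primary : primary \isog [set: parameters].
Proof.
rewrite isog_sym; apply/isogP; exists delta_potential; first exact: injm_delta_potential.
apply/setP => b; apply/morphimP/idP => [[d _ _ ->] | ].
  exact: delta_potential_primary.
by case/primary_delta_potential=> d ->; exists d; rewrite ?inE.
Qed.

Lemma card_contraction_nu0 : #|vertex (contraction_nu G p 0)| = 1%N.
Proof.
have [/card_gt0P[v _] _] := graph_connected G.
rewrite card_contraction_nu; apply/eqP/cards1P; exists (rep 0 v).
by apply/setP => w; rewrite !inE (rep0 w v) eq_sym.
Qed.

Lemma leq_card_contraction_nu i j : i <= j ->
  #|vertex (contraction_nu G p i)| <= #|vertex (contraction_nu G p j)|.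
Proof.
move=> le_ij; rewrite !card_contraction_nu; apply/subset_leq_card/subsetP => v.
by rewrite !inE => /eqP/(rep_anti le_ij)/eqP.
Qed.

(** The factor p^e accounts for the constant potentials, which the coboundary
forgets. *)
Lemma card_primary : (forall q, q \in [pchar k]%R -> coprime q l) ->
  (p ^ E * #|primary|)%N = (p ^ #|vertex_union G p|)%N.
Proof.
move=> k_pchar; rewrite (card_isog isog_primary) cardsT card_dep_ffun foldrE big_map.
have card_muE j : j < E -> #|{: mu k (p ^ j.+1)}| = (p ^ j.+1)%N.
  move=> jE; apply: card_mu => [|q /k_pchar]; first exact: pexp_gt0.
  by apply: coprime_dvdr; apply: dvdn_pexp_l.
pose N j := #|vertex (contraction_nu G p j)|.
rewrite big_enum (eq_bigr (fun j : 'I_E => p ^ (j.+1 * (N (E - j) - N (E - j.+1))))%N);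
    last first.
  move=> j _; rewrite card_dep_ffun foldrE big_map big_enum prod_nat_const.
  by rewrite card_ord card_muE // expnM /alpha addn1 subnSK.
have N0 : N 0 = 1%N := card_contraction_nu0.
have N_mono : {homo N : i j / (i <= j)%N} by move=> i j; apply: leq_card_contraction_nu.
rewrite -expn_sum -expnD /vertex_union card_tagged sumnE big_map big_enum /=.
by rewrite -(sum_weighted_diff E N_mono) N0 muln1 addnC.
Qed.

End PrimaryPart.

(** * The ghost group *)

Lemma ghost_group_dprod (k : closedFieldType) (g l : nat) (G : level_graph g l) :
    (0 < l)%N ->
  \big[dprod/1]_(p <- primes l) primary k G p = ghost_group G k.
Proof.
move=> l_gt0; apply: (abelian_dprod_Ldiv l_gt0 (ghost_group_abelian k G)) => b _.
by apply/ffunP => e; rewrite expg_ffun oneg_ffun mu_expg.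
Qed.

Theorem lemma2p22 (k : closedFieldType) (g l : nat) (G : level_graph g l)
    (hg : (4 <= g)%N) (hl : (1 <= l)%N)
    (hk : forall p, p \in [pchar k]%R -> coprime p l) :
  [/\ \big[dprod/1]_(p <- primes l)
         \prod_(1 <= j < (logn p l).+1) im_delta_nu G k p j
      = ghost_group G k,
      ghost_group G k \isog
        [set: {dffun forall p : seq_sub (primes l),
               {dffun forall j : 'I_(logn (val p) l),
                {dffun forall _ : 'I_(alpha G (val p) j.+1),
                  mu k (val p ^ j.+1)}}}]
    & (#|ghost_group G k|%:R
      = l%:R^-1 * (\prod_(p <- primes l) p ^ #|vertex_union G p|)%N%:R :> rat)%R].
Proof.
have ghost_dprod := ghost_group_dprod k G hl.
split.
- rewrite -[RHS]ghost_dprod; apply: eq_big_seq => p p_l.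
  exact: prod_im_delta_nu.
- apply: (@isog_bigdprod _ _ _ (fun p : seq_sub (primes l) => primary_group k G (val p))).
  + exact: ghost_group_abelian.
  + rewrite -[RHS]ghost_dprod -(big_map val xpredT (primary k G)); apply: perm_big.
    apply: uniq_perm; rewrite ?primes_uniq ?(map_inj_uniq val_inj) ?index_enum_uniq //.
    move=> p; apply/mapP/idP => [[q _ ->] | p_l]; first exact: valP.
    by exists (SeqSub p_l); rewrite ?mem_index_enum.
  by move=> p; apply: isog_primary hl (valP p).
have l_neq0 : (l%:R != 0 :> rat)%R by rewrite Num.Theory.pnatr_eq0 -lt0n.
apply: (mulfI l_neq0); rewrite mulVKf // -natrM; congr (_%:R)%R.
rewrite -(bigdprod_card ghost_dprod).
rewrite {1}(prod_prime_decomp hl) prime_decompE big_map -big_split /=.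
by apply: eq_big_seq => p p_l; apply: card_primary.
Qed.
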